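(* Let $\varphi$ be a quasi-concave function for which there is a constant $C>0$ with $\varphi(t)\ge C\,t\log(1+1/t)$ for all $t>0$. Then $\Lambda_\varphi=R(\Lambda_\phi)$ for some quasi-concave function $\phi$ if and only if there exist an increasing sequence $(a_k)_{k\in\mathbb{Z}}$ and a decreasing sequence $(b_k)_{k\in\mathbb{Z}}$ of non-negative real numbers, and a constant $c\ge0$, such that $$\varphi(t)\approx c+t\sum_{k\in\mathbb{Z}}b_k\log\Big(1+\frac{a_k}{t}\Big).$$
   Context: All function spaces consist of measurable functions on $(0,\infty)$ with Lebesgue measure. Equality of spaces means equality as sets with equivalent norms. ''Increasing'' and ''decreasing'' are in the weak sense. $f^*$ is the decreasing rearrangement of $f$. $A\approx B$ means $C_0^{-1}B(t)\le A(t)\le C_0B(t)$ for some constant $C_0>0$ independent of $t>0$. A function $\varphi:(0,\infty)\to(0,\infty)$ is quasi-concave if it is increasing and $\varphi(t)/t$ is decreasing; we put $\varphi(0)=0$. The Lorentz space $\Lambda_\varphi$ consists of all $f$ with $\|f\|_{\Lambda_\varphi}=\int_0^\infty f^*(t)\,d\varphi(t)<\infty$, where the Stieltjes integral includes the mass $\varphi(0+)$ at the origin; equivalently $\|f\|_{\Lambda_\varphi}=\int_0^\infty\varphi(|\{x:|f(x)|>s\}|)\,ds$. For a rearrangement invariant space $X$ on $(0,\infty)$, $W_X(t)=\big\|\frac{1}{1+\cdot/t}\big\|_X$ and $R(X)=\Lambda_{W_X}$; if $1/(1+s)\notin X$ then $R(X)=\{0\}$. *)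

(* Defs.v *)
From HB Require Import structures.
From mathcomp Require Import all_boot all_order all_algebra.
From mathcomp Require Import all_classical all_reals all_analysis.

Set Implicit Arguments.
Unset Strict Implicit.
Unset Printing Implicit Defensive.

Import Order.TTheory GRing.Theory Num.Theory.
Import numFieldNormedType.Exports.

Local Open Scope classical_set_scope.
Local Open Scope ring_scope.

(* Functions on (0,oo) are total functions on R; only their values on
   `]0, +oo[ are ever used. *)

Definition quasi_concave (R : realType) (phi : R -> R) : Prop :=
  [/\ forall t, 0 < t -> 0 < phi t,
      forall s t, 0 < s -> s <= t -> phi s <= phi t
    & forall s t, 0 < s -> s <= t -> phi t / t <= phi s / s].

Definition equivalent_funs (R : realType) (A B : R -> \bar R) : Prop :=
  exists2 C0 : R, 0 < C0 &
    forall t : R, 0 < t -> (C0^-1%:E * B t <= A t <= C0%:E * B t)%E.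

(* Extension of an increasing weight w on (0,oo) to [0,oo], with w(0) = 0 and
   w(oo) = lim_{t -> oo} w(t). *)
Definition weight_ext (R : realType) (w : R -> \bar R) (x : \bar R) : \bar R :=
  match x with
  | r%:E => if 0 < r then w r else 0%E
  | +oo%E => ereal_sup (w @` `]0, +oo[)
  | -oo%E => 0%E
  end.

Definition distribution_fun (R : realType) (f : R -> R) (s : R) : \bar R :=
  lebesgue_measure (`]0, +oo[ `&` [set x | s < `|f x|]).

(* The Lorentz norm, int_0^oo w(|{|f| > s}|) ds, which for quasi-concave w is
   the Stieltjes integral of f^* against w, with the mass w(0+) at the origin.
   The weight may take the value +oo; if w = +oo on all of (0,oo) then the
   norm is 0 when f = 0 a.e. and +oo otherwise, so that the space is {0}. *)
Definition lorentz_norm (R : realType) (w : R -> \bar R) (f : R -> R) : \bar R :=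
  (\int[lebesgue_measure]_(s in `]0%R, +oo[) weight_ext w (distribution_fun f s))%E.

(* A function space is given by its [0,oo]-valued (quasi-)norm functional. *)
Definition fspace (R : realType) (N : (R -> R) -> \bar R) : set (R -> R) :=
  [set f | measurable_fun (`]0, +oo[ : set R) f /\ (N f < +oo)%E].

Definition same_space (R : realType) (N1 N2 : (R -> R) -> \bar R) : Prop :=
  fspace N1 = fspace N2 /\
  exists2 C : R, 0 < C & forall f, fspace N1 f ->
    (C^-1%:E * N2 f <= N1 f <= C%:E * N2 f)%E.

Definition Lorentz (R : realType) (phi : R -> R) : (R -> R) -> \bar R :=
  lorentz_norm (fun t => (phi t)%:E).

Definition W_fun (R : realType) (X : (R -> R) -> \bar R) (t : R) : \bar R :=
  X (fun s => 1 / (1 + s / t)).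

(* When 1/(1+s) is not in X, dilation invariance of X gives W_fun X = +oo on
   (0,oo), hence R(X) = {0}. *)
Definition R_space (R : realType) (X : (R -> R) -> \bar R) : (R -> R) -> \bar R :=
  lorentz_norm (W_fun X).

(* Main.v *)
Require Import Defs.
From mathcomp Require Import all_boot all_order all_algebra.
From mathcomp Require Import all_classical all_reals all_analysis.
From mathcomp Require Import measurable_realfun ring lra zify.

(* Since 1 / (1 + . / t) has distribution function s |-> t (1 / s - 1) on (0,1),
   W_psi(t) is the integral of psi(t (1/s - 1)) over 0 < s < 1, and testing on
   indicators of (0,t) turns the equality of spaces into phi ~ W_psi.  This transform
   is monotone in psi, fixes constants and maps min(., a) to t log(1 + a / t), so it
   maps c + sum_k b_k min(., a_k) exactly to the right-hand side of the theorem.  It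
   remains to write psi, up to the factor 3, as such a sum.  Finiteness of W_psi forces
   psi(u) / u -> 0 at infinity, so h_k = sup_v (psi(v) - 2^-k v) is finite; it is a
   convex function of the slope 2^-k, hence its difference quotients
   a_k = 2^(k+1) (h_(k+1) - h_k) increase with k.  With b_k = 2^-(k+1) and c = psi(0+),
   the sums telescope to c + sum_k b_k min(u, a_k) = inf_k (h_k + 2^-k u), which is
   at least psi(u), and at most 3 psi(u) by choosing 2^-k between psi(u)/u and
   2 psi(u)/u. *)

Set Implicit Arguments.
Unset Strict Implicit.
Unset Printing Implicit Defensive.

Import Order.TTheory GRing.Theory Num.Theory.
Import numFieldNormedType.Exports.

Local Open Scope classical_set_scope.
Local Open Scope ring_scope.

(** * The transform that computes [W_fun] of a Lorentz space *)

Lemma emeasurable_nonincreasing (R : realType) (D : set R) (g : R -> \bar R) :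
  is_interval D ->
  (forall x y, D x -> D y -> x <= y -> (g y <= g x)%E) ->
  measurable_fun D g.
Proof.
move=> iD ng mD.
apply: (measurability _ (ErealGenCInfty.measurableE R)) => //= _ [_] [r] -> <-.
apply: is_interval_measurable => x y /= [Dx rx] [Dy ry] z /andP[xz zy].
have Dz : D z by apply: (iD x y) => //; rewrite xz.
split=> //; move: ry; rewrite !in_itv/= !andbT => /le_trans; apply.
exact: ng.
Qed.

(** Substituting u = t (1/s - 1) gives the integral of G(u) t / (t + u)^2 over u > 0. *)
Definition stieltjes_transform (R : realType) (G : R -> \bar R) (t : R) : \bar R :=
  (\int[lebesgue_measure]_(s in `]0%R, 1%R[) G (t * (s^-1 - 1))%R)%E.

Lemma W_fun_Lorentz (R : realType) (psi : R -> R) (t : R) : 0 < t ->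
  W_fun (Lorentz psi) t = stieltjes_transform (EFin \o psi) t.
Proof.
move=> t0; rewrite /W_fun /Lorentz /lorentz_norm /stieltjes_transform.
have -> : `]0%R, 1%R[%classic = `]0%R, +oo[%classic `&` `]0%R, 1%R[%classic :> set R.
  apply/seteqP; split=> x /=; rewrite !in_itv/= ?andbT; last by case.
  by move=> /andP[-> ->].
rewrite [RHS]integral_mkcondr; apply: eq_integral => s.
rewrite inE/= in_itv/= andbT => s0; rewrite patchE.
have ker x : 0 < x -> `|1 / (1 + x / t)| = 1 / (1 + x / t) :> R.
  by move=> x0; rewrite ger0_norm// divr_ge0// addr_ge0// divr_ge0// ltW.
case: ifPn; rewrite ?inE ?notin_setE /= in_itv/= s0/= => s1.
  have st0 : 0 < t * (s^-1 - 1) by rewrite mulr_gt0// subr_gt0 invf_gt1.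
  rewrite /distribution_fun.
  have -> : `]0%R, +oo[%classic `&` [set x | s < `|1 / (1 + x / t)|] =
    `]0%R, t * (s^-1 - 1)[%classic :> set R.
    have key x : 0 < x -> (s < `|1 / (1 + x / t)|) = (x < t * (s^-1 - 1)).
      move=> x0; rewrite ker// ltr_pdivlMr ?addr_gt0 ?divr_gt0//.
      rewrite -ltr_pdivlMl// mulr1 -ltrBrDl ltr_pdivrMr// mulrC.
      by [].
    apply/seteqP; split=> x /=; rewrite !in_itv/= ?andbT.
      by move=> [x0]; rewrite key// x0.
    by move=> /andP[x0]; rewrite -key.
  rewrite lebesgue_measure_itv/= lte_fin st0.
  by rewrite -EFinB subr0/= st0.
(* For s >= 1 the level set is empty, because 1 / (1 + x / t) <= 1. *)
rewrite /distribution_fun (_ : _ `&` _ = set0) ?measure0 /= ?ltxx//.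
apply/seteqP; split=> x //=; rewrite in_itv/= andbT => -[x0].
rewrite ker// ltNge => /negP; apply; apply: (@le_trans _ _ 1); last first.
  by rewrite leNgt; apply/negP.
by rewrite ler_pdivrMr ?addr_gt0 ?divr_gt0// mul1r lerDl divr_ge0// ltW.
Qed.

Lemma kernel_arg_gt0 (R : realType) (t s : R) : 0 < t -> `]0, 1[%classic s ->
  0 < t * (s^-1 - 1).
Proof.
move=> t0 /=; rewrite in_itv/= => /andP[s0 s1].
by rewrite mulr_gt0// subr_gt0 invf_gt1.
Qed.

Lemma measurable_comp_kernel (R : realType) (G : R -> \bar R) (t : R) : 0 < t ->
  (forall u v : R, 0 < u -> u <= v -> (G u <= G v)%E) ->
  measurable_fun (`]0, 1[ : set R) (fun s => G (t * (s^-1 - 1))).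
Proof.
move=> t0 ndG; apply: emeasurable_nonincreasing; first exact: interval_is_interval.
move=> x y xi yi xy; apply: ndG; first exact: kernel_arg_gt0.
move: xi yi; rewrite /= !in_itv/= => /andP[x0 _] /andP[y0 _].
by rewrite ler_pM2l// lerD2r lef_pV2.
Qed.

Lemma le_stieltjes_transform (R : realType) (F G : R -> \bar R) (t : R) : 0 < t ->
  (forall u v : R, 0 < u -> u <= v -> (F u <= F v)%E) ->
  (forall u v : R, 0 < u -> u <= v -> (G u <= G v)%E) ->
  (forall u : R, 0 < u -> (0 <= F u <= G u)%E) ->
  (stieltjes_transform F t <= stieltjes_transform G t)%E.
Proof.
move=> t0 ndF ndG FG; apply: ge0_le_integral => //.
- by move=> s /(kernel_arg_gt0 t0) /FG /andP[].
- exact: measurable_comp_kernel.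
- exact: measurable_comp_kernel.
- by move=> s /(kernel_arg_gt0 t0) /FG /andP[].
Qed.

Lemma stieltjes_transform_homo (R : realType) (G : R -> \bar R) :
  (forall u : R, 0 < u -> (0 <= G u)%E) ->
  (forall u v : R, 0 < u -> u <= v -> (G u <= G v)%E) ->
  forall t t', 0 < t -> t <= t' ->
  (stieltjes_transform G t <= stieltjes_transform G t')%E.
Proof.
move=> G0 ndG t t' t0 tt'; have t'0 := lt_le_trans t0 tt'.
apply: ge0_le_integral => //.
- by move=> s /(kernel_arg_gt0 t0) /G0.
- exact: measurable_comp_kernel.
- exact: measurable_comp_kernel.
- move=> s si; apply: ndG; first exact: kernel_arg_gt0.
  by rewrite ler_wpM2r// ltW// -[ltRHS]mul1r kernel_arg_gt0.
Qed.

Lemma min_homo (R : realType) (a : R) (u v : R) : u <= v ->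
  ((Num.min u a)%:E <= (Num.min v a)%:E)%E.
Proof. by move=> uv; rewrite lee_fin le_min !ge_min uv lexx orbT. Qed.

(** The integrand is cut at r = t / (t + a), where t (1/r - 1) = a. Below r it is the constant a and
    contributes a r = t (1 - r). Above r the primitive t (ln s - s) contributes t (r - 1 - ln r).
    The total is - t ln r, and 1/r = 1 + a/t. *)
Lemma stieltjes_transform_min (R : realType) (a t : R) : 0 <= a -> 0 < t ->
  stieltjes_transform (fun u => (Num.min u a)%:E) t = (t * ln (1 + a / t))%:E.
Proof.
move=> a0 t0; rewrite /stieltjes_transform.
have [->|an0] := eqVneq a 0.
  rewrite mul0r addr0 ln1 mulr0; apply: integral0_eq => s /(kernel_arg_gt0 t0) s0.
  by rewrite min_r// ltW.
have {an0 a0}a0 : 0 < a by rewrite lt_def an0.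
pose r := t / (t + a).
have ta0 : 0 < t + a by rewrite addr_gt0.
have r0 : 0 < r by rewrite divr_gt0.
have r1 : r < 1 by rewrite ltr_pdivrMr// mul1r ltrDl.
have mt : measurable_fun (`]0, 1[ : set R)
    (fun s => (Num.min (t * (s^-1 - 1)) a)%:E).
  by apply: (@measurable_comp_kernel R (fun u => (Num.min u a)%:E)) => // u v _; exact: min_homo.
have sp : `]0%R, 1%R[%classic = `]0%R, r[%classic `|` `[r, 1%R[%classic :> set R.
  by rewrite -itv_bndbnd_setU// bnd_simp ltW.
have argr : t * (r^-1 - 1) = a.
  by rewrite /r invf_div mulrBr mulr1 mulrCA divff ?gt_eqF// mulr1 addrAC subrr add0r.
rewrite sp ge0_integral_setU//; last 3 first.
- by move: mt; rewrite sp.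
- move=> s ss; have : `]0, 1[%classic s by rewrite sp.
  move=> /(kernel_arg_gt0 t0) s0.
  by rewrite lee_fin le_min ltW//= ltW.
- apply/disj_setPS => s [] /=; rewrite !in_itv/= => /andP[_ sr] /andP[rs _].
  by move: (lt_le_trans sr rs); rewrite ltxx.
have -> : (\int[lebesgue_measure]_(s in `]0%R, r[) (Num.min (t * (s^-1 - 1)) a)%:E =
    (a * r)%:E)%E.
  rewrite (eq_integral (cst a%:E)); last first.
    move=> s; rewrite inE/= in_itv/= => /andP[s0 sr]; rewrite min_r//=.
    by rewrite -argr ler_pM2l// lerD2r lef_pV2// ltW.
  by rewrite integral_cst//= lebesgue_measure_itv/= lte_fin r0 sube0 -EFinM.
have -> : (\int[lebesgue_measure]_(s in `[r, 1%R[) (Num.min (t * (s^-1 - 1)) a)%:E =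
    \int[lebesgue_measure]_(s in `[r, 1%R[) (t * (s^-1 - 1))%:E)%E.
  apply: eq_integral => s; rewrite inE/= in_itv/= => /andP[rs s1]; rewrite min_l//=.
  by rewrite -argr ler_pM2l// lerD2r lef_pV2// posrE (lt_le_trans r0 rs).
rewrite integral_itv_bndo_bndc; last first.
  apply: (@emeasurable_nonincreasing R _ (fun s => (t * (s^-1 - 1))%:E)).
    exact: interval_is_interval.
  move=> x y /=; rewrite !in_itv/= => /andP[rx _] /andP[ry _] xy.
  by rewrite lee_fin ler_pM2l// lerD2r lef_pV2// posrE (lt_le_trans r0).
rewrite (@continuous_FTC2 _ _ (fun s => t * (ln s - s)))//.
- rewrite -EFinB -EFinD; congr EFin; rewrite ln1 -/r.
  have -> : 1 + a / t = r^-1 by rewrite /r invf_div mulrDl divff ?gt_eqF.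
  rewrite lnV ?posrE//.
  have -> : a * r = t * (1 - r).
    by rewrite /r; field; rewrite gt_eqF.
  ring.
- apply/continuous_in_subspaceT => s; rewrite inE/= in_itv/= => /andP[rs _].
  have s0 : s != 0 by rewrite gt_eqF// (lt_le_trans r0).
  apply: cvgM; first exact: cvg_cst.
  by apply: cvgB; [exact: cvgV|exact: cvg_cst].
- have cF s : 0 < s -> {for s, continuous (fun s : R => t * (ln s - s))}.
    move=> s0; apply: cvgM; first exact: cvg_cst.
    by apply: cvgB; [exact: continuous_ln|exact: cvg_id].
  split.
  + move=> s; rewrite in_itv/= => /andP[rs _].
    apply: derivableM => //; apply: derivableB => //.
    by apply: ex_derive; apply: is_derive1_ln; exact: lt_trans rs.
  + by apply: cvg_at_right_filter; exact: cF.
  + by apply: cvg_at_left_filter; exact: cF.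
- move=> s; rewrite in_itv/= => /andP[rs _].
  have s0 : 0 < s by exact: lt_trans rs.
  have dl : is_derive s 1 (@ln R) s^-1 := is_derive1_ln s0.
  by rewrite derive1E derive_val.
Qed.

(** * Lorentz norms as functions of the weight *)

Lemma weight_ext_homo (R : realType) (w : R -> \bar R) :
  (forall u : R, 0 < u -> (0 <= w u)%E) ->
  (forall u v : R, 0 < u -> u <= v -> (w u <= w v)%E) ->
  forall x y : \bar R, (x <= y)%E -> (weight_ext w x <= weight_ext w y)%E.
Proof.
move=> w0 ndw [x| |] [y| |] //=.
- rewrite lee_fin => xy; case: ifPn => x0; first by rewrite (lt_le_trans x0)// ndw.
  by case: ifPn => // /w0.
- move=> _; case: ifPn => x0.
    by apply: ereal_sup_ubound; exists x => //=; rewrite in_itv/= x0.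
  apply: le_trans (w0 1 _) _ => //; apply: ereal_sup_ubound; exists 1 => //=.
  by rewrite in_itv/= ltr01.
- by move=> _; case: ifPn => // /w0.
- move=> _; apply: le_trans (w0 1 _) _ => //; apply: ereal_sup_ubound.
  by exists 1 => //=; rewrite in_itv/= ltr01.
Qed.

Lemma weight_ext_le (R : realType) (w1 w2 : R -> \bar R) (K : R) : 0 <= K ->
  (forall u : R, 0 < u -> (w1 u <= K%:E * w2 u)%E) ->
  forall x, (weight_ext w1 x <= K%:E * weight_ext w2 x)%E.
Proof.
move=> K0 w12 [x| |] /=; last by rewrite mule0.
  by case: ifPn => [/w12//|_]; rewrite mule0.
apply: ge_ereal_sup => _ [x /=] /[!in_itv]/= /andP[x0 _] <-.
apply: le_trans (w12 _ x0) _; apply: lee_wpmul2l; first by rewrite lee_fin.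
by apply: ereal_sup_ubound; exists x => //=; rewrite in_itv/= x0.
Qed.

Lemma distribution_fun_nonincreasing (R : realType) (f : R -> R) :
  measurable_fun (`]0, +oo[ : set R) f ->
  forall s s', s <= s' -> (distribution_fun f s' <= distribution_fun f s)%E.
Proof.
move=> mf s s' ss'.
have mdist (r : R) : measurable (`]0, +oo[%classic `&` [set x | r < `|f x|] : set R).
  have mnf : measurable_fun (`]0, +oo[ : set R) (fun x => `|f x|).
    by apply: measurableT_comp => //; exact: normr_measurable.
  have -> : [set x | r < `|f x|] = (fun x => `|f x|) @^-1` `]r, +oo[%classic.
    by apply/seteqP; split=> x /=; rewrite in_itv/= andbT.
  exact: mnf.
apply: le_measure; rewrite ?inE; [exact: mdist|exact: mdist|].
by move=> x /= [x0 s'x]; split=> //; exact: le_lt_trans ss' s'x.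
Qed.

Lemma le_lorentz_norm (R : realType) (w1 w2 : R -> \bar R) (K : R) (f : R -> R) :
  0 <= K -> measurable_fun (`]0, +oo[ : set R) f ->
  (forall u : R, 0 < u -> (0 <= w1 u)%E) ->
  (forall u : R, 0 < u -> (0 <= w2 u)%E) ->
  (forall u v : R, 0 < u -> u <= v -> (w1 u <= w1 v)%E) ->
  (forall u v : R, 0 < u -> u <= v -> (w2 u <= w2 v)%E) ->
  (forall u : R, 0 < u -> (w1 u <= K%:E * w2 u)%E) ->
  (lorentz_norm w1 f <= K%:E * lorentz_norm w2 f)%E.
Proof.
move=> K0 mf w10 w20 nd1 nd2 w12.
have m w : (forall u : R, 0 < u -> (0 <= w u)%E) ->
    (forall u v : R, 0 < u -> u <= v -> (w u <= w v)%E) ->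
    measurable_fun (`]0, +oo[ : set R) (fun s => weight_ext w (distribution_fun f s)).
  move=> w0 ndw; apply: emeasurable_nonincreasing; first exact: interval_is_interval.
  move=> x y _ _ xy; apply: weight_ext_homo => //.
  exact: distribution_fun_nonincreasing.
have wge0 w (w0 : forall u : R, 0 < u -> (0 <= w u)%E) x : (0 <= weight_ext w x)%E.
  case: x => [x| |] //=; first by case: ifPn => // /w0.
  apply: le_trans (w0 1 _) _ => //; apply: ereal_sup_ubound.
  by exists 1 => //=; rewrite in_itv/= ltr01.
rewrite -ge0_integralZl_EFin//; last 2 first.
- by move=> s _; exact: wge0.
- exact: m.
apply: ge0_le_integral => //.
- by move=> s _; exact: wge0.
- exact: m.
- by apply: measurable_funeM; exact: m.
- by move=> s _; exact: weight_ext_le.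
Qed.

(** The distribution function of the indicator is t for 0 < s < 1 and 0 for s >= 1. *)
Lemma lorentz_norm_indic (R : realType) (w : R -> \bar R) (t : R) : 0 < t ->
  lorentz_norm w (\1_(`]0, t[%classic : set R)) = w t.
Proof.
move=> t0; rewrite /lorentz_norm.
transitivity (\int[lebesgue_measure]_(s in `]0%R, 1%R[) (cst (w t)) s)%E.
  have -> : `]0%R, 1%R[%classic = `]0%R, +oo[%classic `&` `]0%R, 1%R[%classic :> set R.
    apply/seteqP; split=> x /=; rewrite !in_itv/= ?andbT; last by case.
    by move=> /andP[-> ->].
  rewrite [RHS]integral_mkcondr; apply: eq_integral => s.
  rewrite inE/= in_itv/= andbT => s0; rewrite patchE /distribution_fun.
  case: ifPn; rewrite ?inE ?notin_setE /= in_itv/= s0/= => s1.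
    have -> : `]0%R, +oo[%classic `&` [set x | s < `|\1_(`]0, t[%classic : set R) x|] =
        `]0%R, t[%classic :> set R.
      apply/seteqP; split=> x /=; rewrite !in_itv/= ?andbT indicE.
        move=> [x0]; case: (boolP (x \in _)); first by rewrite inE/= in_itv.
        by rewrite normr0 ltNge ltW.
      by move=> /andP[x0 xt]; rewrite mem_set/= ?in_itv/= ?x0// normr1.
    rewrite lebesgue_measure_itv/= lte_fin t0.
    by rewrite -EFinB subr0/= t0.
  rewrite (_ : _ `&` _ = set0) ?measure0 /= ?ltxx//.
  apply/seteqP; split=> x //= -[_]; rewrite indicE => h; apply: s1; apply: lt_le_trans h _.
  by case: (_ \in _); rewrite ?normr1// normr0.
by rewrite integral_cst//= lebesgue_measure_itv/= lte_fin ltr01 sube0 mule1.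
Qed.

(** From left to right, the norms are compared on the indicator of (0,t), which lies in the space
    because [phi t] is finite. Conversely, [le_lorentz_norm] carries the pointwise bounds over to
    the norms with the same constant, which gives equality of the sets as well. *)
Lemma same_space_lorentzP (R : realType) (phi : R -> R) (w : R -> \bar R) :
  (forall u : R, 0 < u -> 0 <= phi u) ->
  (forall u v : R, 0 < u -> u <= v -> phi u <= phi v) ->
  (forall u : R, 0 < u -> (0 <= w u)%E) ->
  (forall u v : R, 0 < u -> u <= v -> (w u <= w v)%E) ->
  same_space (Lorentz phi) (lorentz_norm w) <->
  equivalent_funs (EFin \o phi) w.
Proof.
move=> p0 ndp w0 ndw; split=> [[_ [C C0 H]]|[C C0 H]].
  exists C => // t t0; rewrite -[w t](lorentz_norm_indic w t0).
  rewrite -[X in (_ <= X <= _)%E](lorentz_norm_indic (EFin \o phi) t0).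
  apply: H; split; last by rewrite /Lorentz lorentz_norm_indic// ltry.
  exact: measurable_indic.
have le1 f : measurable_fun (`]0, +oo[ : set R) f ->
    (Lorentz phi f <= C%:E * lorentz_norm w f)%E.
  move=> mf; apply: le_lorentz_norm => //; first exact: ltW.
  by move=> u u0; have /andP[] := H u u0.
have le2 f : measurable_fun (`]0, +oo[ : set R) f ->
    (lorentz_norm w f <= C%:E * Lorentz phi f)%E.
  move=> mf; apply: le_lorentz_norm => //; first exact: ltW.
  by move=> u u0; have /andP[+ _] := H u u0; rewrite lee_pdivrMl.
split.
  apply/seteqP; split=> f [mf fin]; split=> //.
    by apply: le_lt_trans (le2 _ mf) _; rewrite lte_mul_pinfty// lee_fin ltW.
  by apply: le_lt_trans (le1 _ mf) _; rewrite lte_mul_pinfty// lee_fin ltW.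
exists C => // f [mf _]; rewrite le1// andbT.
by rewrite lee_pdivrMl// le2.
Qed.

(** * Sums of nonnegative terms over the integers *)

(** The enumeration 0, -1, 1, -2, 2, ...; its first 2n values fill the block from -n to n - 1. *)
Definition int_of_nat (n : nat) : int := if odd n then Negz n./2 else Posz n./2.

Lemma int_of_nat_bij : set_bij [set: nat] [set: int] int_of_nat.
Proof.
split=> //.
  move=> m n _ _; rewrite /int_of_nat.
  case: ifPn => om; case: ifPn => on // [] h.
    by rewrite -[m]odd_double_half -[n]odd_double_half om on h.
  by rewrite -[m]odd_double_half -[n]odd_double_half (negbTE om) (negbTE on) h.
move=> [k|k] _ /=.
  by exists k.*2 => //; rewrite /int_of_nat odd_double doubleK.
by exists k.*2.+1 => //; rewrite /int_of_nat /= odd_double/= uphalf_double.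
Qed.

Lemma esum_int (R : realType) (F : int -> \bar R) : (forall k, (0 <= F k)%E) ->
  (\esum_(k in [set: int]) F k = \sum_(n <oo) F (int_of_nat n))%E.
Proof.
by move=> F0; rewrite (reindex_esum _ _ _ _ int_of_nat_bij) nneseries_esumT.
Qed.

Lemma esum_intZl (R : realType) (F : int -> \bar R) (x : R) : (forall k, (0 <= F k)%E) ->
  0 <= x ->
  (\esum_(k in [set: int]) (x%:E * F k) = x%:E * \esum_(k in [set: int]) F k)%E.
Proof.
move=> F0 x0; rewrite !esum_int//; first by rewrite nneseriesZl.
by move=> k; rewrite mule_ge0// lee_fin.
Qed.

Lemma sum_int_of_nat (R : realType) (F : int -> R) (n : nat) :
  \sum_(i < n.*2) F (int_of_nat i) = \sum_(i < n.*2) F (- n%:Z + i%:Z).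
Proof.
elim: n => [|n IH]; first by rewrite !big_ord0.
rewrite doubleS 2![in LHS]big_ord_recr/= IH.
rewrite [in RHS]big_ord_recl/= [in RHS]big_ord_recr/= addrCA -addrA; congr +%R.
  by apply: eq_bigr => i _; rewrite /bump/= add1n; congr F; lia.
rewrite /int_of_nat /= odd_double/= uphalf_double doubleK /bump/= add1n.
by rewrite addrC; congr (F _ + F _); lia.
Qed.

(** Blocks of consecutive integers suffice: the first n terms of the enumeration are among its first
    2n, which form such a block. *)
Lemma esum_int_le (R : realType) (F : int -> R) (B : R) : (forall k, 0 <= F k) ->
  (forall m n, \sum_(i < n) F (m + i%:Z) <= B) ->
  (\esum_(k in [set: int]) (F k)%:E <= B%:E)%E.
Proof.
move=> F0 FB; rewrite esum_int => [|k]; last by rewrite lee_fin.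
apply: lime_le; first by apply: is_cvg_nneseries => n _ _; rewrite lee_fin.
apply: nearW => n; apply: (@le_trans _ _ (\sum_(0 <= i < n.*2) (F (int_of_nat i))%:E)%E).
  by apply: lee_sum_nneg_natr => //; [move=> k _ _; rewrite lee_fin|lia].
by rewrite big_mkord sumEFin lee_fin sum_int_of_nat.
Qed.

Lemma esum_int_ge (R : realType) (F : int -> R) (m : int) (n : nat) :
  ((\sum_(i < n) F (m + i%:Z))%:E <= \esum_(k in [set: int]) (F k)%:E)%E.
Proof.
apply: esum_ge; exists ((fun i : nat => m + i%:Z) @` `I_n).
  by split=> //; apply: finite_image; exact: finite_II.
rewrite (@reindex_fsbig _ _ _ _ _ (fun i : nat => m + i%:Z) `I_n); last first.
  by apply: inj_bij => i j _ _ /addrI [].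
by rewrite -fsbig_ord sumEFin.
Qed.

(** * Sums of truncations and their transforms *)

Definition concave_sum (R : realType) (a b : int -> R) (c u : R) : \bar R :=
  (c%:E + \esum_(k in [set: int]) (b k * Num.min u (a k))%:E)%E.

Definition log_sum (R : realType) (a b : int -> R) (c t : R) : \bar R :=
  (c%:E + t%:E * \esum_(k in [set: int]) (b k * ln (1 + a k / t))%:E)%E.

Lemma concave_sum_homo (R : realType) (a b : int -> R) (c u v : R) :
  (forall k, 0 <= b k) -> u <= v ->
  (concave_sum a b c u <= concave_sum a b c v)%E.
Proof.
move=> b0 uv; rewrite leeD2l//; apply: le_esum => k _.
by rewrite lee_fin ler_wpM2l// -lee_fin min_homo.
Qed.

Lemma concave_sum_ge0 (R : realType) (a b : int -> R) (c u : R) :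
  (forall k, 0 <= a k /\ 0 <= b k) -> 0 <= c -> 0 < u ->
  (0 <= concave_sum a b c u)%E.
Proof.
move=> ab0 c0 u0; apply: adde_ge0; first by rewrite lee_fin.
apply: esum_ge0 => k _; have [a0 b0] := ab0 k.
by rewrite lee_fin mulr_ge0// le_min a0 ltW.
Qed.

(** All terms are nonnegative, so the series is integrated term by term and each term is given by
    [stieltjes_transform_min]. No finiteness is assumed; both sides may be +oo. *)
Lemma stieltjes_transform_concave_sum (R : realType) (a b : int -> R) (c t : R) :
  (forall k, 0 <= a k /\ 0 <= b k) -> 0 <= c -> 0 < t ->
  stieltjes_transform (concave_sum a b c) t = log_sum a b c t.
Proof.
move=> ab0 c0 t0; rewrite /stieltjes_transform.
have a0 k : 0 <= a k by have [] := ab0 k.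
have b0 k : 0 <= b k by have [] := ab0 k.
have min0 u k : 0 < u -> 0 <= Num.min u (a k) by move=> u0; rewrite le_min a0 ltW.
have mmin k : measurable_fun (`]0, 1[ : set R)
    (fun s => (Num.min (t * (s^-1 - 1)) (a k))%:E).
  apply: (@measurable_comp_kernel R (fun u => (Num.min u (a k))%:E)) => // u v _.
  exact: min_homo.
have mbmin k : measurable_fun (`]0, 1[ : set R)
    (fun s => (b k * Num.min (t * (s^-1 - 1)) (a k))%:E).
  apply: (@measurable_comp_kernel R (fun u => (b k * Num.min u (a k))%:E)) => // u v _ uv.
  by rewrite lee_fin ler_wpM2l// -lee_fin min_homo.
under eq_integral => s.
  rewrite inE => /(kernel_arg_gt0 t0) s0; rewrite /concave_sum esum_int; last first.
    by move=> k; rewrite lee_fin mulr_ge0// min0.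
  over.
rewrite ge0_integralD//=; last 2 first.
- by move=> s s01; apply: nneseries_ge0 => n _ _; rewrite lee_fin mulr_ge0// min0// kernel_arg_gt0.
- apply: ge0_emeasurable_sum.
    by move=> n s s01 _; rewrite lee_fin mulr_ge0// min0// kernel_arg_gt0.
  by move=> n _; exact: mbmin.
rewrite integral_cst//= lebesgue_measure_itv/= lte_fin ltr01 sube0 mule1; congr (_ + _)%E.
rewrite integral_nneseries//=; last 2 first.
- by move=> n; exact: mbmin.
- by move=> n s s01; rewrite lee_fin mulr_ge0// min0// kernel_arg_gt0.
have ln0 k : 0 <= ln (1 + a k / t).
  by rewrite ln_ge0// lerDl divr_ge0// ltW.
rewrite esum_int; last by move=> k; rewrite lee_fin mulr_ge0.
rewrite -nneseriesZl; last by move=> k _; rewrite lee_fin mulr_ge0.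
apply: eq_eseriesr => n _.
under eq_integral do rewrite EFinM.
rewrite ge0_integralZl_EFin//; last 2 first.
- by move=> s s01; rewrite lee_fin min0// kernel_arg_gt0.
- exact: mmin.
have := stieltjes_transform_min (a0 (int_of_nat n)) t0.
rewrite /stieltjes_transform => ->.
by rewrite -!EFinM mulrCA.
Qed.

(** * The dyadic scale *)

Lemma addzS (m : int) (n : nat) : m + n%:Z + 1 = m + n.+1%:Z.
Proof. by rewrite -addrA -PoszD addn1. Qed.

Lemma homo_int_step (R : realType) (f : int -> R) :
  (forall k, f k <= f (k + 1)) -> {homo f : i j / i <= j}.
Proof.
move=> fS i j; rewrite -subr_ge0 => ij; rewrite -(subrK i j) addrC.
case: (j - i) ij => // n _; elim: n => [|n IH]; first by rewrite addr0.
by apply: le_trans IH _; rewrite -addzS.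
Qed.

Definition dyadic (R : realType) (k : int) : R := 2 ^ (- k).

Lemma dyadic_gt0 (R : realType) k : 0 < dyadic R k.
Proof. by rewrite exprz_gt0. Qed.

Lemma dyadicS (R : realType) k : dyadic R k = 2 * dyadic R (k + 1).
Proof.
rewrite /dyadic -[X in X * _](expr1z (2 : R)) -expfzDr ?pnatr_eq0//.
by congr (_ ^ _); lia.
Qed.

Lemma dyadicD (R : realType) k (n : nat) : dyadic R (k + n%:Z) = dyadic R k / 2 ^+ n.
Proof. by rewrite /dyadic opprD expfzDr ?pnatr_eq0// -exprnN. Qed.

Lemma exists_pow2_ge (R : realType) (x : R) : exists n : nat, x <= 2 ^+ n.
Proof.
exists (Num.bound `|x|); apply: (@le_trans _ _ (Num.bound `|x|)%:R).
  by apply: le_trans (ler_norm x) _; rewrite ltW// archi_boundP.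
by rewrite -natrX ler_nat ltnW// ltn_expl.
Qed.

Lemma exists_dyadic_ge (R : realType) (x : R) : exists k, x <= dyadic R k.
Proof.
by have [n xn] := exists_pow2_ge x; exists (- n%:Z); rewrite /dyadic opprK.
Qed.

Lemma exists_dyadic_le (R : realType) (x : R) m : 0 < x ->
  exists n : nat, dyadic R (m + n%:Z) <= x.
Proof.
move=> x0; have [n xn] := exists_pow2_ge (dyadic R m / x); exists n.
by rewrite dyadicD ler_pdivrMr ?exprn_gt0// mulrC -ler_pdivrMr.
Qed.

(** Going down from some dyadic value >= x, the first one that is <= 2 x works: either it is the
    starting value, or its predecessor exceeds 2 x and half of that exceeds x. *)
Lemma exists_dyadic (R : realType) (x : R) : 0 < x ->
  exists k, x <= dyadic R k <= 2 * x.
Proof.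
move=> x0; have [m xm] := exists_dyadic_ge x.
have ex : exists n : nat, dyadic R (m + n%:Z) <= 2 * x.
  by apply: exists_dyadic_le; rewrite mulr_gt0.
have [[|n] nx minn] := ex_minnP ex.
  by exists m; rewrite xm; move: nx; rewrite addr0.
exists (m + n.+1%:Z); rewrite nx andbT.
have : ~~ (dyadic R (m + n%:Z) <= 2 * x).
  by apply/negP => /minn; rewrite ltnn.
rewrite -ltNge dyadicS ltr_pM2l// => /ltW.
by rewrite addzS.
Qed.

(** * Discretization of a quasi-concave function by lines of dyadic slope *)

Section discretization.
Context {R : realType} (psi : R -> R).
Hypothesis psi_qc : quasi_concave psi.
Hypothesis psi_o : forall e : R, 0 < e -> exists2 v, 0 < v & psi v <= e * v.

(** A Legendre conjugate: the least intercept of a line of slope 2^-k lying above psi. As psi(v)/v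
    is decreasing, [psi_o] says that it tends to 0 at infinity, which makes the supremum finite. *)
Definition dyadic_conjugate (k : int) : R :=
  sup [set psi v - dyadic R k * v | v in `]0, +oo[%classic].
Local Notation h := dyadic_conjugate.

(** By monotonicity this infimum is the limit psi(0+). *)
Definition psi_origin : R := inf (psi @` `]0, +oo[%classic).
Local Notation c := psi_origin.

(** As 2^-(k+1) = 2^-k - 2^-(k+1), this is also the drop in slope from line k to line k + 1. *)
Definition dyadic_slope (k : int) : R := dyadic R (k + 1).
Local Notation b := dyadic_slope.

(** The abscissa at which lines k and k + 1 cross. *)
Definition dyadic_node (k : int) : R := (h (k + 1) - h k) / b k.
Local Notation a := dyadic_node.

(** Up to u, monotonicity of psi suffices. Beyond u, psi(v)/v <= psi(u)/u <= e makes the left side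
    nonpositive. *)
Lemma psi_minus_linear_le (e u v : R) : 0 < u -> 0 < v -> 0 <= e -> psi u <= e * u ->
  psi v - e * v <= psi u.
Proof.
have [p0 ndp nip] := psi_qc => u0 v0 e0 ueu.
have [vu|uv] := leP v u.
  by apply: le_trans (ndp _ _ v0 vu); rewrite lerBlDr lerDl mulr_ge0// ltW.
apply: (@le_trans _ _ 0); last by rewrite ltW// p0.
rewrite subr_le0 -ler_pdivrMr//; apply: le_trans (nip u v u0 (ltW uv)) _.
by rewrite ler_pdivrMr.
Qed.

Lemma dyadic_conjugate_ub k v : 0 < v -> psi v <= h k + dyadic R k * v.
Proof.
move=> v0; rewrite -lerBlDr; apply: ub_le_sup; last first.
  by exists v => //=; rewrite in_itv/= v0.
(* [sup] is meaningful only for a bounded set; [psi u] is an upper bound here. *)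
have [u u0 ueu] := psi_o (dyadic_gt0 R k).
exists (psi u) => _ [w /=] /[!in_itv]/= /andP[w0 _] <-.
by apply: psi_minus_linear_le => //; rewrite ltW// dyadic_gt0.
Qed.

Lemma dyadic_conjugate_le k x :
  (forall v, 0 < v -> psi v <= x + dyadic R k * v) -> h k <= x.
Proof.
move=> H; apply: ge_sup.
  by exists (psi 1 - dyadic R k * 1); exists 1 => //=; rewrite in_itv/= ltr01.
move=> _ [v /=] /[!in_itv]/= /andP[v0 _] <-.
by rewrite lerBlDr H.
Qed.

Lemma dyadic_conjugate_le_psi k u : 0 < u -> psi u <= dyadic R k * u -> h k <= psi u.
Proof.
move=> u0 ueu; apply: dyadic_conjugate_le => v v0; rewrite -lerBlDr.
by apply: psi_minus_linear_le => //; rewrite ltW// dyadic_gt0.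
Qed.

Lemma psi_origin_le u : 0 < u -> c <= psi u.
Proof.
move=> u0; apply: ge_inf; last by exists u => //=; rewrite in_itv/= u0.
exists 0 => _ [v /=] /[!in_itv]/= /andP[v0 _] <-.
by have [p0 _ _] := psi_qc; rewrite ltW// p0.
Qed.

Lemma psi_origin_ge0 : 0 <= c.
Proof.
apply: lb_le_inf; first by exists (psi 1); exists 1 => //=; rewrite in_itv/= ltr01.
move=> _ [v /=] /[!in_itv]/= /andP[v0 _] <-.
by have [p0 _ _] := psi_qc; rewrite ltW// p0.
Qed.

Lemma psi_origin_le_conjugate k : c <= h k.
Proof.
apply/ler_addgt0Pr => e e0.
(* At this abscissa the linear term 2^-k v is exactly e. *)
have v0 : 0 < e / dyadic R k by rewrite divr_gt0// dyadic_gt0.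
apply: le_trans (psi_origin_le v0) _.
by rewrite (le_trans (dyadic_conjugate_ub k v0))// mulrC divfK// gt_eqF// dyadic_gt0.
Qed.

(** Steep lines have intercepts close to psi(0+): take u with psi(u) < c + e, then a slope at least
    psi(u)/u, so that h_k <= psi(u). *)
Lemma dyadic_conjugate_cvg (e : R) : 0 < e -> exists k, h k <= c + e.
Proof.
move=> e0; have [|_ [u /=] /[!in_itv]/= /andP[u0 _] <- uc] := @inf_adherent _ (psi @` `]0, +oo[%classic) _ e0.
  split; first by exists (psi 1); exists 1 => //=; rewrite in_itv/= ltr01.
  exists 0 => _ [v /=] /[!in_itv]/= /andP[v0 _] <-.
  by have [p0 _ _] := psi_qc; rewrite ltW// p0.
have [k kx] := exists_dyadic_ge (psi u / u); exists k.
apply: le_trans (ltW uc); apply: dyadic_conjugate_le_psi => //.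
by rewrite -ler_pdivrMr.
Qed.

Lemma dyadic_slope_gt0 k : 0 < b k.
Proof. exact: dyadic_gt0. Qed.

Lemma dyadic_slopeE k : b k = dyadic R k - dyadic R (k + 1).
Proof. by rewrite /b (dyadicS R k); lra. Qed.

Lemma slope_node k : b k * a k = h (k + 1) - h k.
Proof. by rewrite mulrC divfK// gt_eqF// dyadic_slope_gt0. Qed.

Lemma dyadic_conjugateS k : h k <= h (k + 1).
Proof.
apply: dyadic_conjugate_le => v v0; apply: le_trans (dyadic_conjugate_ub (k + 1) v0) _.
by rewrite lerD2l ler_pM2r// [leRHS]dyadicS ler_peMl ?ler1n// ltW// dyadic_gt0.
Qed.

Lemma dyadic_node_ge0 k : 0 <= a k.
Proof. by rewrite divr_ge0 ?subr_ge0 ?dyadic_conjugateS// ltW// dyadic_slope_gt0. Qed.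

(** Convexity of the conjugate in the slope: 2^-(k+1) is the mean of 2^-k and 2^-(k+2) with weights
    1/3 and 2/3. *)
Lemma dyadic_conjugate_convex k : 3 * h (k + 1) <= h k + 2 * h (k + 1 + 1).
Proof.
rewrite -ler_pdivlMl//; apply: dyadic_conjugate_le => v v0.
have := dyadic_conjugate_ub k v0; have := dyadic_conjugate_ub (k + 1 + 1) v0.
rewrite (dyadicS R k) (dyadicS R (k + 1)) -!mulrA; lra.
Qed.

(** Since b_k = 2 b_(k+1), the claim a_k <= a_(k+1) is [dyadic_conjugate_convex] rearranged. *)
Lemma dyadic_node_homo : {homo a : i j / i <= j}.
Proof.
apply: homo_int_step => k; rewrite /a ler_pdivrMr ?dyadic_slope_gt0// mulrAC.
rewrite ler_pdivlMr ?dyadic_slope_gt0// /b [X in _ <= _ * X]dyadicS.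
have := dyadic_conjugate_convex k; have := dyadic_gt0 R (k + 1 + 1).
move: (dyadic R _) => x x0 H.
by rewrite [leRHS]mulrA ler_pM2r//; lra.
Qed.

Lemma dyadic_slope_homo : {homo b : i j / i <= j >-> j <= i}.
Proof.
move=> i j ij; rewrite -lerN2; apply: (homo_int_step (f := fun k => - b k)) => // k.
by rewrite lerN2 /b [leRHS]dyadicS ler_peMl ?ler1n// ltW// dyadic_gt0.
Qed.

(* Both cases telescope: [b k * a k = h (k + 1) - h k], and once [u < a m] every
   later term is [b k * u = (dyadic k - dyadic (k + 1)) * u]. *)
Lemma concave_partial_sum_ge u m n : 0 < u ->
  psi u - h m - dyadic R (m + n%:Z) * u
    <= \sum_(i < n) b (m + i%:Z) * Num.min u (a (m + i%:Z)).
Proof.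
move=> u0; elim: n m => [|n IH] m.
  by rewrite big_ord0 addr0; have := dyadic_conjugate_ub m u0; lra.
have [um|mu] := ltP u (a m).
  have -> : \sum_(i < n.+1) b (m + i%:Z) * Num.min u (a (m + i%:Z)) =
      (dyadic R m - dyadic R (m + n.+1%:Z)) * u.
    rewrite (eq_bigr (fun i : 'I_n.+1 => b (m + i%:Z) * u)); last first.
      move=> i _; rewrite min_l//; apply: le_trans (ltW um) _.
      by apply: dyadic_node_homo; rewrite lerDl.
    elim: n.+1 => [|k IHk]; first by rewrite big_ord0 addr0 subrr mul0r.
    rewrite big_ord_recr/= IHk dyadic_slopeE -mulrDl; congr (_ * _).
    by rewrite addzS; lra.
  by have := dyadic_conjugate_ub m u0; lra.
rewrite big_ord_recl/= addr0 min_r// slope_node.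
have := IH (m + 1).
have -> : m + 1 + n%:Z = m + n.+1%:Z by lia.
rewrite (eq_bigr (fun i : 'I_n => b (m + (bump 0 i)%:Z) *
    Num.min u (a (m + (bump 0 i)%:Z)))) => [|i _]; last first.
  by rewrite /bump add1n (_ : m + 1 + i%:Z = m + i.+1%:Z)//; lia.
by move: (\sum_(i < n) _) => s; lra.
Qed.

(** The comparison sequence g follows the intercepts h_j up to j = k and then the single line k. Its
    increments dominate the terms, by min(u, a_j) <= a_j for j < k and min(u, a_j) <= u for j >= k.
    The sum of increments telescopes, and g stays between c and h_k + 2^-k u. *)
Lemma concave_partial_sum_le u k m n : 0 < u ->
  \sum_(i < n) b (m + i%:Z) * Num.min u (a (m + i%:Z)) <= h k + dyadic R k * u - c.
Proof.
move=> u0.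
pose g j := if j <= k then h j else h k + (dyadic R k - dyadic R j) * u.
have step j : b j * Num.min u (a j) <= g (j + 1) - g j.
  rewrite /g; have [jk|kj|jk] := ltgtP j k.
  - rewrite (_ : j + 1 <= k); last by lia.
    by rewrite -slope_node ler_pM2l ?dyadic_slope_gt0// ge_min lexx orbT.
  - rewrite (_ : (j + 1 <= k) = false); last by lia.
    apply: (@le_trans _ _ (b j * u)).
      by rewrite ler_pM2l ?dyadic_slope_gt0// ge_min lexx.
    by rewrite dyadic_slopeE; lra.
  - rewrite jk (_ : (k + 1 <= k) = false); last by lia.
    apply: (@le_trans _ _ (b k * u)).
      by rewrite ler_pM2l ?dyadic_slope_gt0// ge_min lexx.
    by rewrite dyadic_slopeE; lra.
have tele : \sum_(i < n) b (m + i%:Z) * Num.min u (a (m + i%:Z)) <= g (m + n%:Z) - g m.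
  elim: n => [|n IH]; first by rewrite big_ord0 addr0 subrr.
  rewrite big_ord_recr/=; have := step (m + n%:Z).
  by rewrite addzS; lra.
apply: le_trans tele _; apply: lerB.
  rewrite /g; case: ifPn => [jk|_].
    apply: (@le_trans _ _ (h k)); first by apply: homo_int_step jk => j; exact: dyadic_conjugateS.
    by rewrite lerDl mulr_ge0// ltW// dyadic_gt0.
  by rewrite lerD2l ler_pM2r// gerBl ltW// dyadic_gt0.
rewrite /g; case: ifPn => [_|]; first exact: psi_origin_le_conjugate.
rewrite -ltNge => /ltW kj; apply: (le_trans (psi_origin_le_conjugate k)).
rewrite lerDl mulr_ge0 ?(ltW u0)// subr_ge0.
rewrite -lerN2; apply: (homo_int_step (f := fun k => - dyadic R k)) kj => i.
by rewrite lerN2 [leRHS]dyadicS ler_peMl ?ler1n// ltW// dyadic_gt0.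
Qed.

Lemma concave_sum_approx u : 0 < u ->
  ((psi u)%:E <= concave_sum a b c u <= 3%:E * (psi u)%:E)%E.
Proof.
move=> u0; have F0 k : 0 <= b k * Num.min u (a k).
  by rewrite mulr_ge0 ?(ltW (dyadic_slope_gt0 k))// le_min (ltW u0) dyadic_node_ge0.
apply/andP; split.
  apply/lee_addgt0Pr => e e0.
  (* One half of e covers h_m - c, the other the remainder 2^-(m+n) u. *)
  have e20 : 0 < e / 2 by rewrite divr_gt0.
  have [m hm] := dyadic_conjugate_cvg e20.
  have [n nu] := exists_dyadic_le m (divr_gt0 e20 u0).
  have := esum_int_ge (fun k => b k * Num.min u (a k)) m n.
  rewrite /concave_sum => H; apply: (le_trans _ (leeD2r e%:E (leeD2l c%:E H))).
  rewrite -!EFinD lee_fin; have := concave_partial_sum_ge m n u0.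
  by move: nu; rewrite ler_pdivlMr//; lra.
have [p0 _ _] := psi_qc.
(* The lower bound on 2^-k gives h_k <= psi(u), the upper one 2^-k u <= 2 psi(u); together they make
   the factor 3. *)
have [k /andP[xk kx]] := exists_dyadic (divr_gt0 (p0 _ u0) u0).
have hk : h k <= psi u by apply: dyadic_conjugate_le_psi => //; rewrite -ler_pdivrMr.
have ku : dyadic R k * u <= 2 * psi u by rewrite -ler_pdivlMr// -mulrA.
have := @esum_int_le R (fun k => b k * Num.min u (a k)) _ F0
  (fun m n => concave_partial_sum_le k m n u0).
rewrite /concave_sum => H; apply: (le_trans (leeD2l c%:E H)).
by rewrite -EFinD -EFinM lee_fin; lra.
Qed.

End discretization.

(** * Reduction to equivalence of functions, and finiteness of the sums *)

Lemma stieltjes_transformZl (R : realType) (G : R -> \bar R) (x t : R) : 0 <= x -> 0 < t ->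
  (forall u : R, 0 < u -> (0 <= G u)%E) ->
  (forall u v : R, 0 < u -> u <= v -> (G u <= G v)%E) ->
  stieltjes_transform (fun u => x%:E * G u)%E t = (x%:E * stieltjes_transform G t)%E.
Proof.
move=> x0 t0 G0 ndG; rewrite /stieltjes_transform ge0_integralZl_EFin//.
- by move=> s /(kernel_arg_gt0 t0) /G0.
- exact: measurable_comp_kernel.
Qed.

Lemma quasi_concave_ge0 (R : realType) (psi : R -> R) : quasi_concave psi ->
  forall u : R, 0 < u -> (0 <= (EFin \o psi) u)%E.
Proof. by move=> [p0 _ _] u u0; rewrite lee_fin ltW// p0. Qed.

Lemma quasi_concave_homo (R : realType) (psi : R -> R) : quasi_concave psi ->
  forall u v : R, 0 < u -> u <= v -> ((EFin \o psi) u <= (EFin \o psi) v)%E.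
Proof. by move=> [_ nd _] u v u0 uv; rewrite lee_fin nd. Qed.

Lemma same_space_R_spaceP (R : realType) (phi psi : R -> R) :
  quasi_concave phi -> quasi_concave psi ->
  same_space (Lorentz phi) (R_space (Lorentz psi)) <->
  equivalent_funs (EFin \o phi) (stieltjes_transform (EFin \o psi)).
Proof.
move=> phi_qc psi_qc; have [p0 nd _] := phi_qc.
have W u : 0 < u -> W_fun (Lorentz psi) u = stieltjes_transform (EFin \o psi) u.
  exact: W_fun_Lorentz.
have W0 u : 0 < u -> (0 <= W_fun (Lorentz psi) u)%E.
  move=> u0; rewrite W//; apply: integral_ge0 => s /(kernel_arg_gt0 u0).
  exact: quasi_concave_ge0.
have Wnd u v : 0 < u -> u <= v -> (W_fun (Lorentz psi) u <= W_fun (Lorentz psi) v)%E.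
  move=> u0 uv; rewrite !W ?(lt_le_trans u0)//; apply: stieltjes_transform_homo => //.
    exact: quasi_concave_ge0.
  exact: quasi_concave_homo.
apply: (iff_trans (same_space_lorentzP _ nd W0 Wnd)) => [u u0|]; first exact/ltW/p0.
by split=> -[C C0 H]; exists C => // t t0; have := H t t0; rewrite W.
Qed.

(** Otherwise psi(v) >= e v for all v > 0, so psi dominates e min(v, a) for every a. The transform
    at 1 is then at least e ln(1 + a), which is unbounded in a. *)
Lemma stieltjes_transform_fin_num_sublinear (R : realType) (psi : R -> R) :
  quasi_concave psi -> (stieltjes_transform (EFin \o psi) 1 < +oo)%E ->
  forall e : R, 0 < e -> exists2 v, 0 < v & psi v <= e * v.
Proof.
move=> psi_qc Wfin e e0; apply: contrapT => npsi.
have psi_ge v : 0 < v -> e * v <= psi v.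
  by move=> v0; rewrite leNgt; apply/negP => /ltW psiv; apply: npsi; exists v.
have ge0 := quasi_concave_ge0 psi_qc; have nd := quasi_concave_homo psi_qc.
have W_ge a : 0 <= a -> ((ln (1 + a))%:E <= e^-1%:E * stieltjes_transform (EFin \o psi) 1)%E.
  move=> a0; rewrite -[ln _]mul1r -[a in ln (1 + a)]divr1 -stieltjes_transform_min//.
  rewrite -stieltjes_transformZl ?invr_ge0 ?(ltW e0)//; apply: le_stieltjes_transform => //.
  - by move=> u v _; exact: min_homo.
  - by move=> u v u0 uv; rewrite lee_wpmul2l ?lee_fin ?invr_ge0 ?(ltW e0)//; exact: nd.
  - move=> u u0; rewrite lee_fin le_min (ltW u0) a0/= -EFinM lee_fin ge_min.
    by rewrite ler_pdivlMl// psi_ge.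
have Wfn : stieltjes_transform (EFin \o psi) 1 \is a fin_num.
  rewrite ge0_fin_numE//; apply: integral_ge0 => s /(kernel_arg_gt0 ltr01).
  exact: ge0.
(* M exceeds the supposed bound by 1, and a = exp M gives ln(1 + a) >= M. *)
pose M := e^-1 * fine (stieltjes_transform (EFin \o psi) 1) + 1.
have := W_ge (expR M) (expR_ge0 _); rewrite -[X in (_ * X)%E]fineK// -EFinM lee_fin.
apply/negP; rewrite -ltNge (@lt_le_trans _ _ M)//; first by rewrite ltrDl.
by rewrite -[leLHS]expRK ler_ln ?posrE ?expR_gt0 ?addr_gt0 ?expR_gt0// lerDr.
Qed.

Lemma min_le_ln (R : realType) (a u : R) : 0 <= a -> 0 < u ->
  Num.min u a <= 2 * (u * ln (1 + a / u)).
Proof.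
move=> a0 u0; have ua0 : 0 < u + a by rewrite ltr_wpDr.
have x0 : 0 < 1 + a / u by rewrite ltr_wpDr// divr_ge0// ltW.
(* [ln x >= 1 - x^-1] at [x = 1 + a / u]. *)
have lnge : a / (u + a) <= ln (1 + a / u).
  rewrite -[ln _]opprK -lnV ?posrE// lerNr.
  have -> : (1 + a / u)^-1 = 1 + - (a / (u + a)).
    by field; rewrite !gt_eqF.
  by apply: le_ln1Dx; rewrite ltrN2 ltr_pdivrMr// mul1r ltrDr.
apply: (@le_trans _ _ (2 * (u * (a / (u + a))))); last first.
  by rewrite ler_pM2l// ler_pM2l.
rewrite mulrA mulrA ler_pdivlMr//.
(* From u + a <= 2 max(u, a) one gets min(u, a) (u + a) <= 2 u a. *)
have [ua|au] := leP u a; nra.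
Qed.

(** This transfers finiteness from the logarithmic sum to the sum of truncations. *)
Lemma concave_sum_le_log_sum (R : realType) (a b : int -> R) (c u : R) :
  (forall k, 0 <= a k /\ 0 <= b k) -> 0 <= c -> 0 < u ->
  (concave_sum a b c u <= 2%:E * log_sum a b c u)%E.
Proof.
move=> ab0 c0 u0.
have F0 k : 0 <= b k * ln (1 + a k / u).
  by have [a0 b0] := ab0 k; rewrite mulr_ge0// ln_ge0// lerDl divr_ge0// ltW.
rewrite /log_sum ge0_muleDr; last 2 first.
- by rewrite lee_fin.
- by rewrite mule_ge0 ?lee_fin ?(ltW u0)//; apply: esum_ge0 => k _; rewrite lee_fin.
rewrite muleA -(EFinM 2 u) -esum_intZl; last 2 first.
- by move=> k; rewrite lee_fin.
- by rewrite mulr_ge0// ltW.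
apply: leeD; first by rewrite -EFinM lee_fin; lra.
apply: le_esum => k _; have [a0 b0] := ab0 k; rewrite -EFinM lee_fin mulrCA ler_wpM2l//.
by rewrite -mulrA min_le_ln.
Qed.

(** The decrease of S(u)/u, in multiplicative form because S may be +oo; each min(u, a_k) has this
    property, and so does the constant c. *)
Lemma concave_sum_quasi (R : realType) (a b : int -> R) (c u v : R) :
  (forall k, 0 <= a k /\ 0 <= b k) -> 0 <= c -> 0 < u -> u <= v ->
  (concave_sum a b c v <= (v / u)%:E * concave_sum a b c u)%E.
Proof.
move=> ab0 c0 u0 uv; have uv1 : 1 <= v / u by rewrite ler_pdivlMr// mul1r.
have F0 k : 0 <= b k * Num.min u (a k).
  by have [a0 b0] := ab0 k; rewrite mulr_ge0// le_min a0 ltW.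
rewrite /concave_sum ge0_muleDr; last 2 first.
- by rewrite lee_fin.
- by apply: esum_ge0 => k _; rewrite lee_fin.
rewrite -esum_intZl; last 2 first.
- by move=> k; rewrite lee_fin.
- exact: le_trans uv1.
apply: leeD; first by rewrite -EFinM lee_fin ler_peMl.
apply: le_esum => k _; have [a0 b0] := ab0 k; rewrite -EFinM lee_fin mulrCA ler_wpM2l//.
have [ua|au] := leP u (a k); first by rewrite divfK ?gt_eqF// ge_min lexx.
by rewrite ge_min; apply/orP; right; rewrite ler_peMl.
Qed.

(** * The characterization *)

Theorem theorem5p3 (R : realType) (phi : R -> R)
    (phi_qc : quasi_concave phi)
    (phi_lb : exists2 C : R, 0 < C &
       forall t : R, 0 < t -> C * t * ln (1 + 1 / t) <= phi t) :
  (exists2 psi : R -> R, quasi_concave psi &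
     same_space (Lorentz phi) (R_space (Lorentz psi)))
  <->
  (exists (a b : int -> R) (c : R),
     [/\ {homo a : i j / i <= j}, {homo b : i j / i <= j >-> j <= i},
         forall k, 0 <= a k /\ 0 <= b k, 0 <= c
       & equivalent_funs (fun t => (phi t)%:E)
           (fun t => c%:E + t%:E *
              \esum_(k in [set: int]) (b k * ln (1 + a k / t))%:E)%E]).
Proof.
split=> [[psi psi_qc /same_space_R_spaceP -/(_ phi_qc psi_qc) [C C0 phiW]]|].
  (* As phi(1) is a real number, equivalence forces the transform to be finite at 1. *)
  have W1 : (stieltjes_transform (EFin \o psi) 1 < +oo)%E.
    have /andP[+ _] := phiW 1 ltr01; rewrite lee_pdivrMl// => /le_lt_trans; apply.
    by rewrite lte_mul_pinfty ?ltry// lee_fin ltW.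
  have psi_o := stieltjes_transform_fin_num_sublinear psi_qc W1.
  have ge0 := quasi_concave_ge0 psi_qc; have nd := quasi_concave_homo psi_qc.
  have ab0 k : 0 <= dyadic_node psi k /\ 0 <= @dyadic_slope R k.
    by split; [exact: dyadic_node_ge0|exact/ltW/dyadic_slope_gt0].
  have c0 := psi_origin_ge0 psi_qc.
  exists (dyadic_node psi), (@dyadic_slope R), (psi_origin psi); split=> //.
  - exact: dyadic_node_homo.
  - exact: dyadic_slope_homo.
  (* C comes from phi ~ W_psi and 3 from [concave_sum_approx]. *)
  exists (3 * C) => [|t t0]; first by rewrite mulr_gt0.
  have /andP[phi_ge phi_le] := phiW t t0.
  rewrite -/(log_sum (dyadic_node psi) (@dyadic_slope R) (psi_origin psi) t).
  rewrite -stieltjes_transform_concave_sum//.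
  set S := concave_sum _ _ _.
  have Snd (u v : R) : 0 < u -> u <= v -> (S u <= S v)%E.
    by move=> _ uv; apply: concave_sum_homo => // k; have [] := ab0 k.
  have S_ge u : 0 < u -> ((psi u)%:E <= S u)%E.
    by move=> u0; have /andP[] := concave_sum_approx psi_qc psi_o u0.
  have S_le u : 0 < u -> (S u <= 3%:E * (psi u)%:E)%E.
    by move=> u0; have /andP[] := concave_sum_approx psi_qc psi_o u0.
  apply/andP; split.
    rewrite lee_pdivrMl ?mulr_gt0// EFinM -muleA.
    apply: (@le_trans _ _ (3%:E * stieltjes_transform (EFin \o psi) t)%E).
      rewrite -stieltjes_transformZl//; apply: le_stieltjes_transform => //.
        by move=> u v u0 uv; rewrite lee_wpmul2l ?lee_fin//; exact: nd.
      by move=> u u0; rewrite concave_sum_ge0//=; exact: S_le.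
    by rewrite lee_wpmul2l ?lee_fin// -lee_pdivrMl.
  have W0 : (0 <= stieltjes_transform (EFin \o psi) t)%E.
    by apply: integral_ge0 => s /(kernel_arg_gt0 t0) /ge0.
  apply: (le_trans phi_le); apply: lee_pmul => //; first by rewrite lee_fin ltW.
    by rewrite lee_fin ler_pMl//; lra.
  by apply: le_stieltjes_transform => // u u0; rewrite ge0//= S_ge.
move=> [a [b [c [_ _ ab0 c0 [C C0 phiB]]]]].
(* Conversely, the sum of truncations itself serves as psi, once it is known to be finite and
   positive. *)
pose S := concave_sum a b c.
have B_fin (t : R) : 0 < t -> (log_sum a b c t < +oo)%E.
  move=> t0; have /andP[+ _] := phiB t t0; rewrite lee_pdivrMl// => /le_lt_trans; apply.
  by rewrite lte_mul_pinfty ?ltry// lee_fin ltW.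
have S_ge0 (u : R) : 0 < u -> (0 <= S u)%E by move=> u0; exact: concave_sum_ge0.
have S_fin (u : R) : 0 < u -> (fine (S u))%:E = S u.
  move=> u0; rewrite fineK// ge0_fin_numE ?S_ge0//.
  apply: le_lt_trans (concave_sum_le_log_sum ab0 c0 u0) _.
  by rewrite lte_mul_pinfty// B_fin.
have Snd (u v : R) : 0 < u -> u <= v -> (S u <= S v)%E.
  by move=> _ uv; apply: concave_sum_homo => // k; have [] := ab0 k.
have [phi0 _ _] := phi_qc.
have S_gt0 (u : R) : 0 < u -> (0 < S u)%E.
  (* A zero of S at one point spreads to all points, to the left by monotonicity and to the right by
     [concave_sum_quasi]. The logarithmic sum at 1 would then vanish, against phi(1) > 0. *)
  move=> u0; rewrite lt_def S_ge0// andbT; apply/eqP => Su0.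
  have Sv0 v : 0 < v -> S v = 0%E.
    move=> v0; apply/eqP; rewrite eq_le S_ge0// andbT.
    have [uv|/ltW vu] := leP u v; last by rewrite -Su0 Snd.
    by apply: le_trans (concave_sum_quasi ab0 c0 u0 uv) _; rewrite -/S Su0 mule0.
  have /andP[_] := phiB 1 ltr01; apply/negP; rewrite -ltNge.
  rewrite -/(log_sum a b c 1) -stieltjes_transform_concave_sum//.
  rewrite /stieltjes_transform integral0_eq ?mule0 ?lte_fin ?phi0// => s.
  by move=> /(kernel_arg_gt0 ltr01) /Sv0.
pose psi u := fine (S u).
have psi_qc : quasi_concave psi.
  split=> [t t0|s t s0 st|s t s0 st].
  - by rewrite -lte_fin S_fin// S_gt0.
  - by rewrite -lee_fin !S_fin ?Snd// (lt_le_trans s0).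
  - have t0 := lt_le_trans s0 st.
    have := concave_sum_quasi ab0 c0 s0 st.
    rewrite -/S -(S_fin s s0) -(S_fin t t0) -EFinM lee_fin -/(psi _) -/(psi _) => psi_le.
    by rewrite ler_pdivrMr// mulrAC -mulrA mulrC.
exists psi => //; apply/same_space_R_spaceP => //; exists C => // t t0.
have -> : stieltjes_transform (EFin \o psi) t = log_sum a b c t.
  rewrite -stieltjes_transform_concave_sum//; apply: eq_integral => s.
  by rewrite inE => /(kernel_arg_gt0 t0) /S_fin.
exact: phiB.
Qed.
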